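(* Let $q$ be a prime power and $\nu\ge 1$ an integer. The symplectic graph $Sp(2\nu,q)$ is a strongly regular graph with parameters $$\left(\frac{q^{2\nu}-1}{q-1},\; q^{2\nu-1},\; q^{2\nu-2}(q-1),\; q^{2\nu-2}(q-1)\right)$$ and eigenvalues $q^{2\nu-1}$, $q^{\nu-1}$ and $-q^{\nu-1}$.
   Context: Let $\mathbb{F}_q$ be the finite field with $q$ elements (any characteristic), and let $\mathbb{F}_q^{(2\nu)}$ be the $2\nu$-dimensional space of row vectors over $\mathbb{F}_q$. Let $K$ be the $2\nu\times 2\nu$ block diagonal matrix over $\mathbb{F}_q$ with $\nu$ diagonal blocks all equal to $\begin{pmatrix}0&1\\-1&0\end{pmatrix}$. For a nonzero row vector $\alpha$, $[\alpha]$ denotes the one-dimensional subspace spanned by $\alpha$. The symplectic graph $Sp(2\nu,q)$ is the graph whose vertices are the one-dimensional subspaces of $\mathbb{F}_q^{(2\nu)}$, with $[\alpha]$ adjacent to $[\beta]$ if and only if $\alpha K\,{}^t\!\beta\neq 0$ (where ${}^t\!\beta$ is the transpose of $\beta$). A finite simple graph is strongly regular with parameters $(v,k,\lambda,\mu)$ if it has $v$ vertices, every vertex has degree $k$, any two distinct adjacent vertices have exactly $\lambda$ common neighbours, and any two distinct non-adjacent vertices have exactly $\mu$ common neighbours (a condition that is vacuous if the graph is complete). The eigenvalues of a graph are the eigenvalues of its adjacency matrix.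
   Formalization: The claim that q^(ν−1) is an eigenvalue is made only for ν ≥ 2: for ν = 1 the graph is the complete graph on q+1 vertices, whose only eigenvalues are q and −1, so 1 is not one; everything else is stated for all ν ≥ 1. *)

(* Defs.v *)
From HB Require Import structures.
From mathcomp Require Import all_boot all_order all_algebra.

Set Implicit Arguments.
Unset Strict Implicit.
Unset Printing Implicit Defensive.

Import GRing.Theory.

HB.instance Definition _ (F : finFieldType) (V : vectType F) :=
  isCountable.Build {vspace V}
    (pcan_pickleK (can_pcan (@VectorInternalTheory.vs2mxK F V))).
HB.instance Definition _ (F : finFieldType) (V : vectType F) :=
  isFinite.Build {vspace V}
    (pcan_enumP (can_pcan (@VectorInternalTheory.vs2mxK F V))).

Record strongly_regular (T : finType) (e : rel T) (v k l m : nat) : Prop :=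
  StronglyRegular {
    srg_sym : symmetric e;
    srg_irr : irreflexive e;
    srg_card : #|T| = v;
    srg_deg : forall x, #|[set y | e x y]| = k;
    srg_adj : forall x y, x != y -> e x y -> #|[set z | e x z & e y z]| = l;
    srg_nadj : forall x y, x != y -> ~~ e x y -> #|[set z | e x z & e y z]| = m
  }.

Local Open Scope ring_scope.

Definition adjacency_mx (R : pzSemiRingType) (T : finType) (e : rel T) :
    'M[R]_#|T| :=
  \matrix_(i, j) (e (enum_val i) (enum_val j))%:R.

Section SymplecticGraph.
Variables (F : finFieldType) (nu : nat).

Definition symp_block : 'M[F]_2 := block_mx (0 : 'M_1) 1%:M (- 1%:M) (0 : 'M_1).

Lemma symp_dim : (\sum_(i < nu) 2 = 2 * nu)%N.
Proof. by rewrite sum_nat_const card_ord mulnC. Qed.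

(* The type of \mxdiag has dimension \sum_(i < nu) 2, which is only
   propositionally equal to 2 * nu, hence the cast. *)
Definition symp_K : 'M[F]_(2 * nu) :=
  castmx (symp_dim, symp_dim) (\mxdiag_(i < nu) symp_block).

Definition sp_vertex : finType :=
  {U : {vspace 'rV[F]_(2 * nu)} | \dim U == 1%N}.

(* The vectors a and b are necessarily nonzero; by sp_adjE below, the
   condition does not depend on their choice. *)
Definition sp_adj : rel sp_vertex := fun U V =>
  [exists a : 'rV[F]_(2 * nu), exists b : 'rV[F]_(2 * nu),
    [&& val U == <[a]>%VS, val V == <[b]>%VS & a *m symp_K *m b^T != 0]].

Lemma sp_adjE (U V : sp_vertex) (a b : 'rV[F]_(2 * nu)) :
  val U = <[a]>%VS -> val V = <[b]>%VS ->
  sp_adj U V = (a *m symp_K *m b^T != 0).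
Proof.
move=> Ua Vb; apply/existsP/idP => [[a' /existsP[b' /and3P[]]]|nz].
  rewrite Ua Vb => /eqP ea /eqP eb; apply: contra => /eqP ab0.
  have /vlineP[c ->] : a' \in <[a]>%VS by rewrite ea memv_line.
  have /vlineP[d ->] : b' \in <[b]>%VS by rewrite eb memv_line.
  by rewrite linearZ -!scalemxAl -scalemxAr ab0 !scaler0.
by exists a; apply/existsP; exists b; rewrite Ua Vb !eqxx.
Qed.

End SymplecticGraph.

(* Main.v *)
(* For representatives x, y of two distinct points, the functionals z |-> z K x^T
   and z |-> z K y^T are linearly independent, so the number of z at which both
   are nonzero does not depend on whether x and y are adjacent: lambda = mu.
   Hence A ^ 2 = (k - mu) I + mu J with k - mu = q ^ (2 nu - 2).  An eigenvector
   is therefore either non-orthogonal to the constants, with eigenvalue k, or has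
   eigenvalue a with a ^ 2 = q ^ (2 nu - 2).  Conversely, if a ^ 2 = k - mu and
   u has sum zero, then w = u A + a u satisfies w A = a w and only has to be
   nonzero: take u = e_i - e_j with a different from the (i, j) entry of A. *)

Require Import Defs.
From mathcomp Require Import all_boot all_order all_algebra zify.

Import Order.TTheory GRing.Theory Num.Theory.
Local Open Scope ring_scope.

(** * The alternating nondegenerate form given by [symp_K] *)

(** Each block is E - E^T, where E has a single 1 in its upper right corner. This is stronger than
    skew-symmetry in characteristic 2: it makes the form alternating, hence the graph loopless, in
    every characteristic. *)
Lemma symp_K_skew (F : finFieldType) (nu : nat) :
  exists M : 'M[F]_(2 * nu), symp_K F nu = M - M^T.
Proof.
pose B : 'M[F]_2 := block_mx (0 : 'M_1) 1%:M (0 : 'M_1) (0 : 'M_1).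
exists (castmx (symp_dim nu, symp_dim nu) (\mxdiag_(i < nu) B)).
rewrite trmx_cast /= tr_mxdiag /symp_K; case: _ / (symp_dim nu).
rewrite !castmx_id -mxdiagB; apply: eq_mxdiag => _.
rewrite /symp_block /B (@tr_block_mx _ 1 1 1 1) !trmx0 trmx1.
by rewrite (@opp_block_mx _ 1 1 1 1) (@add_block_mx _ 1 1 1 1) !subr0 sub0r.
Qed.

Lemma symp_K_sqr (F : finFieldType) (nu : nat) :
  symp_K F nu *m symp_K F nu = - 1%:M.
Proof.
rewrite /symp_K; case: _ / (symp_dim nu); rewrite !castmx_id.
rewrite {2}/mxdiag mul_mxdiag_mxblock -[1%:M]mxdiagZ -mxdiagN.
apply: eq_mxblock => i j; case: ifP => _; last exact: mulmx0.
rewrite !conform_mx_id (@mulmx_block _ 1 1 1 1 1 1) !mul0mx !mulmx0.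
rewrite !mul1mx !mulmx1 !(addr0, add0r).
by rewrite (@scalar_mx_block _ 1 1) (@opp_block_mx _ 1 1 1 1) !oppr0.
Qed.

Lemma symp_K_unit (F : finFieldType) (nu : nat) : symp_K F nu \in unitmx.
Proof.
have /mulmx1_unit[//] : symp_K F nu *m (- symp_K F nu) = 1%:M.
by rewrite mulmxN symp_K_sqr opprK.
Qed.

Lemma trmx11 (R : pzSemiRingType) (c : 'M[R]_1) : c^T = c.
Proof. by rewrite [c]mx11_scalar tr_scalar_mx. Qed.

Lemma mx11_eq0 (R : pzSemiRingType) (c : 'M[R]_1) : (c == 0) = (c 0 0 == 0).
Proof.
apply/eqP/eqP => [-> | c0]; first by rewrite mxE.
by apply/matrixP => i j; rewrite !ord1 c0 mxE.
Qed.

Lemma symp_form_alt (F : finFieldType) (nu : nat) (a : 'rV[F]_(2 * nu)) :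
  a *m symp_K F nu *m a^T = 0.
Proof.
have [M ->] := symp_K_skew F nu.
rewrite mulmxBr mulmxBl -[X in _ - X]trmx11 !trmx_mul !trmxK mulmxA.
exact: subrr.
Qed.

Lemma symp_form_skew (F : finFieldType) (nu : nat) (a b : 'rV[F]_(2 * nu)) :
  a *m symp_K F nu *m b^T = - (b *m symp_K F nu *m a^T).
Proof.
have [M ->] := symp_K_skew F nu.
rewrite -[LHS]trmx11 !trmx_mul trmxK raddfB /= trmxK mulmxA.
by rewrite -mulNmx -mulmxN opprB.
Qed.

(** * Counting vectors and projective points *)

Lemma card_row_neq0 (F : finFieldType) (k : nat) :
  #|[set w : 'rV[F]_k | [forall j, w 0 j != 0]]| = ((#|F| - 1) ^ k)%N.
Proof.
pose g (f : {ffun 'I_k -> F}) : 'rV[F]_k := \row_j f j.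
have g_inj : injective g.
  by move=> f f' /rowP ff; apply/ffunP => j; have := ff j; rewrite !mxE.
have -> : [set w : 'rV[F]_k | [forall j, w 0 j != 0]] =
          g @: [set f in ffun_on (predC1 (0 : F))].
  apply/setP => w; rewrite inE; apply/forallP/imsetP => [nz | [f]].
    exists [ffun j => w 0 j]; last by apply/rowP => j; rewrite mxE ffunE.
    by rewrite inE; apply/ffun_onP => j; rewrite ffunE !inE nz.
  by rewrite inE => /ffun_onP f0 -> j; rewrite mxE; apply: f0.
by rewrite card_imset // cardsE card_ffun_on card_ord cardC1 subn1.
Qed.

(** Full column rank makes [v |-> v *m A] onto, so its fibres are all translates of the kernel and
    have the same size. *)
Lemma card_preim_mulmx (F : finFieldType) (n k : nat) (A : 'M[F]_(n, k))
    (P : pred 'rV[F]_k) :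
  row_full A ->
  #|[set v | P (v *m A)]| = (#|F| ^ (n - k) * #|[set w | P w]|)%N.
Proof.
move=> Afull; have [B BA] := row_fullP Afull.
have kn : (k <= n)%N by rewrite -(eqP Afull) rank_leq_row.
pose fib (w : 'rV[F]_k) := [set v : 'rV[F]_n | v *m A == w].
have fiber w : #|fib w| = #|fib 0|.
  have -> : fib w = [set v + w *m B | v in fib 0].
    apply/setP => v; rewrite inE; apply/eqP/imsetP => [vw | [u]].
      exists (v - w *m B); last by rewrite subrK.
      by rewrite inE mulmxBl vw -mulmxA BA mulmx1 subrr.
    by rewrite inE => /eqP u0 ->; rewrite mulmxDl u0 -mulmxA BA mulmx1 add0r.
  by rewrite card_imset //; apply: addIr.
have count (Q : pred 'rV[F]_k) :
    #|[set v | Q (v *m A)]| = (#|[set w | Q w]| * #|fib 0%R|)%N.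
  rewrite -sum1dep_card (partition_big (mulmx^~ A) Q) //=.
  rewrite -sum_nat_const big_set /=; apply: eq_bigr => w Qw.
  rewrite sum1dep_card -(fiber w); apply: eq_card => v; rewrite !inE.
  by apply: andb_idl => /eqP ->.
(* Counting with the predicate that is always true determines the kernel size as q^(n - k). *)
have total : #|{: 'rV[F]_n}| = (#|{: 'rV[F]_k}| * #|fib 0%R|)%N.
  have setE d : [set _ : 'rV[F]_d | true] = setT by apply/setP => w; rewrite !inE.
  by have := count predT; rewrite /= !setE !cardsT.
have F0 : (0 < #|F|)%N by apply/card_gt0P; exists 0.
rewrite (count P) mulnC; congr (_ * _)%N; apply/eqP.
rewrite -(@eqn_pmul2l (#|F| ^ k)) ?expn_gt0 ?F0 // -expnD subnKC //.
by rewrite eq_sym; move/eqP: total; rewrite !card_mx !mul1n eq_sym.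
Qed.

(** Every nonzero vector is in exactly one way a nonzero scalar times the chosen vector [vpick] of a
    line. A predicate invariant under scaling and false at 0 therefore selects q - 1 vectors on each
    point that it selects. *)
Lemma card_points (F : finFieldType) (n : nat) (P : pred 'rV[F]_n) :
  ~~ P 0 -> (forall (c : F) v, c != 0 -> P (c *: v) = P v) ->
  ((#|F| - 1) *
   #|[set U : {U : {vspace 'rV[F]_n} | \dim U == 1%N} | P (vpick (val U))]|)%N
  = #|[set v | P v]|.
Proof.
move=> P0 PZ; pose point : finType := {U : {vspace 'rV[F]_n} | \dim U == 1%N}.
pose X := [set U : point | P (vpick (val U))].
pose h (p : F * point) : 'rV[F]_n :=
  p.1 *: vpick (val p.2).
have pick0 (U : point) : vpick (val U) != 0.
  by rewrite vpick0 -dimv_eq0 (eqP (valP U)).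
have lineE (U : point) v :
    v \in val U -> v != 0 -> val U = <[v]>%VS.
  move=> vU v0; apply/eqP; rewrite eq_sym eqEdim -memvE vU dim_vline v0.
  by rewrite (eqP (valP U)).
have h_inj : {in setX [set~ 0] X &, injective h}.
  move=> [c U] [d V]; rewrite !inE /= => /andP[c0 _] /andP[d0 _] cd.
  have UV : U = V.
    apply: val_inj; rewrite (lineE U (h (c, U))).
    - by rewrite cd -(lineE V) ?memvZ ?memv_pick // scaler_eq0 negb_or d0 pick0.
    - by rewrite memvZ ?memv_pick.
    - by rewrite scaler_eq0 negb_or c0 pick0.
  move: cd; rewrite /h /= UV => /eqP; rewrite -subr_eq0 -scalerBl scaler_eq0.
  by rewrite (negPf (pick0 V)) orbF subr_eq0 => /eqP ->.
rewrite subn1 -(cardsC1 (0 : F)) -cardsX -(card_in_imset h_inj).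
apply: eq_card => v; rewrite inE; apply/imsetP/idP => [[[c U]]|Pv].
  by rewrite !inE /= => /andP[c0 PU] ->; rewrite PZ.
have v0 : v != 0 by apply: contraTneq Pv => ->.
have dv : \dim <[v]> == 1%N by rewrite dim_vline v0.
pose U : point := exist _ <[v]>%VS dv.
have /vlineP[c vE] : v \in <[vpick (val U)]>%VS.
  by rewrite -(lineE U) ?memv_pick ?pick0 //= memv_line.
have c0 : c != 0 by apply: contra_neq v0 => c0; rewrite vE c0 scale0r.
by exists (c, U) => //; rewrite !inE c0 /= -(PZ c) // -vE.
Qed.

(** * Vertices, valency and common neighbours of the symplectic graph *)

Lemma sp_vertex_line (F : finFieldType) (nu : nat) (U : sp_vertex F nu) :
  val U = <[vpick (val U)]>%VS /\ vpick (val U) != 0.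
Proof.
have U0 : vpick (val U) != 0 by rewrite vpick0 -dimv_eq0 (eqP (valP U)).
split=> //; apply/eqP; rewrite eq_sym eqEdim -memvE memv_pick dim_vline U0.
by rewrite (eqP (valP U)).
Qed.

Lemma sp_adj_pick (F : finFieldType) (nu : nat) (U V : sp_vertex F nu) :
  sp_adj U V = (vpick (val U) *m symp_K F nu *m (vpick (val V))^T != 0).
Proof.
have [UE _] := sp_vertex_line _ _ U; have [VE _] := sp_vertex_line _ _ V.
exact: sp_adjE.
Qed.

(* With the coordinates of one, resp. two, points as rows of [X], this counts
   the neighbours, resp. the common neighbours. *)
Lemma card_sp_adj_rows (F : finFieldType) (nu k : nat)
    (X : 'M[F]_(k.+1, 2 * nu)) :
  row_free X ->
  #|[set U : sp_vertex F nu |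
      [forall j, (vpick (val U) *m (symp_K F nu *m X^T)) 0 j != 0]]|
  = (#|F| ^ (2 * nu - k.+1) * (#|F| - 1) ^ k)%N.
Proof.
move=> Xfree; have F1 : (0 < #|F| - 1)%N by rewrite subn_gt0 card_finNzRing_gt1.
(* Multiplying by q - 1 replaces points by vectors; the k + 1 nonzero coordinates then give (q -
   1)^(k + 1), one factor more than in the count of points. *)
apply/eqP; rewrite -(eqn_pmul2l F1).
rewrite (@card_points _ _ (fun v => [forall j, (v *m _) 0 j != 0])); first last.
- move=> c v c0; apply: eq_forallb => j.
  by rewrite -scalemxAl mxE mulf_eq0 (negPf c0).
- by rewrite negb_forall; apply/existsP; exists 0; rewrite mul0mx mxE eqxx.
rewrite (@card_preim_mulmx _ _ _ _ (fun w => [forall j, w 0 j != 0])).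
  by rewrite card_row_neq0 expnS mulnCA.
have [B XB] := row_freeP Xfree; apply/row_fullP.
(* A left inverse of K X^T, obtained from the right inverse [B] of [X]. *)
exists (B^T *m invmx (symp_K F nu)).
by rewrite mulmxA mulmxKV ?symp_K_unit // -trmx_mul XB trmx1.
Qed.

Lemma row_free_col_mx2 (F : fieldType) (n : nat) (x y : 'rV[F]_n) :
  x != 0 -> y != 0 -> <[x]>%VS != <[y]>%VS -> row_free (col_mx x y).
Proof.
move=> x0 y0 xy; apply: inj_row_free => v.
rewrite -[v]hsubmxK mul_row_col [lsubmx v]mx11_scalar [rsubmx v]mx11_scalar.
rewrite !mul_scalar_mx; set a := lsubmx v 0 0; set b := rsubmx v 0 0 => ab0.
(* Otherwise [y] would be a multiple of [x], and the two lines would coincide. *)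
have b0 : b = 0.
  apply: contraNeq xy => b0; rewrite eq_sym eqEdim !dim_vline x0 y0 andbT.
  rewrite -memvE; apply/vlineP; exists (- (b^-1 * a)).
  move/eqP: ab0; rewrite addrC addr_eq0 => /eqP yE.
  by rewrite -[y](scalerK b0) yE scalerN scaleNr scalerA.
move: ab0; rewrite b0 scale0r addr0 => /eqP; rewrite scaler_eq0 (negPf x0) orbF.
by move=> /eqP ->; rewrite raddf0 row_mx0.
Qed.

Lemma sp_adj_sym (F : finFieldType) (nu : nat) : symmetric (@sp_adj F nu).
Proof. by move=> U V; rewrite !sp_adj_pick symp_form_skew oppr_eq0. Qed.

Lemma sp_adj_irr (F : finFieldType) (nu : nat) : irreflexive (@sp_adj F nu).
Proof. by move=> U; rewrite sp_adj_pick symp_form_alt eqxx. Qed.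

Lemma card_sp_vertex (F : finFieldType) (nu : nat) :
  ((#|F| - 1) * #|sp_vertex F nu| = #|F| ^ (2 * nu) - 1)%N.
Proof.
have := @card_points F (2 * nu) (fun v => v != 0).
rewrite eqxx => /(_ isT) cardE.
have -> : #|sp_vertex F nu| = #|[set U : sp_vertex F nu | vpick (val U) != 0]|.
  rewrite -cardsT; apply: eq_card => U; rewrite !inE.
  by have [_ ->] := sp_vertex_line _ _ U.
rewrite cardE => [|c v c0]; last by rewrite scaler_eq0 (negPf c0).
rewrite -[(2 * nu)%N in RHS]mul1n -card_mx -cardsT [in RHS](cardsD1 0).
rewrite in_setT add1n subn1 /=.
by apply: eq_card => v; rewrite !inE andbT.
Qed.

Lemma sp_vertex_gt0 (F : finFieldType) (nu : nat) :
  (0 < nu)%N -> (0 < #|sp_vertex F nu|)%N.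
Proof.
move=> nu0; have q1 : (1 < #|F|)%N := card_finNzRing_gt1 _.
rewrite -(@ltn_pmul2l (#|F| - 1)) ?subn_gt0 // muln0 card_sp_vertex subn_gt0.
by rewrite -[X in (X < _)%N](expn0 #|F|) ltn_exp2l // muln_gt0.
Qed.

Lemma sp_adj_degree (F : finFieldType) (nu : nat) (U : sp_vertex F nu) :
  #|[set V | sp_adj U V]| = (#|F| ^ (2 * nu - 1))%N.
Proof.
have [_ U0] := sp_vertex_line _ _ U.
have := @card_sp_adj_rows F nu 0 (vpick (val U)).
rewrite muln1 => <-; last by rewrite /row_free rank_rV U0.
apply: eq_card => V; rewrite !inE sp_adj_sym sp_adj_pick mulmxA.
rewrite mx11_eq0; apply/idP/forallP => [nz j | /(_ 0) //].
by rewrite ord1.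
Qed.

Lemma sp_adj_common (F : finFieldType) (nu : nat) (U V : sp_vertex F nu) :
  U != V ->
  #|[set W | sp_adj U W & sp_adj V W]| = (#|F| ^ (2 * nu - 2) * (#|F| - 1))%N.
Proof.
move=> UV; have [UE U0] := sp_vertex_line _ _ U.
have [VE V0] := sp_vertex_line _ _ V.
have := @card_sp_adj_rows F nu 1 (col_mx (vpick (val U)) (vpick (val V))).
rewrite expn1 => <-; last first.
  by apply: row_free_col_mx2; rewrite // -UE -VE.
apply: eq_card => W; rewrite !inE ![sp_adj _ W]sp_adj_sym !sp_adj_pick.
rewrite mulmxA (@tr_col_mx _ 1 1) (@mul_mx_row _ _ _ 1 1).
set a := _ *m _; set b := _ *m _.
rewrite !mx11_eq0; apply/andP/forallP => [[a0 b0] j | ab].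
  by rewrite mxE; case: splitP => k _; rewrite !ord1.
split; first by have := ab (@lshift 1 1 0); rewrite (@row_mxEl _ 1 1 1).
by have := ab (@rshift 1 1 0); rewrite (@row_mxEr _ 1 1 1).
Qed.

(** * Eigenvalues of a strongly regular graph with lambda = mu *)

Lemma adjacency_mx_const (R : pzSemiRingType) (T : finType) (e : rel T) (k : nat) :
  (forall x, #|[set y | e x y]| = k) ->
  adjacency_mx R e *m const_mx 1 = k%:R *: const_mx 1 :> 'cV_#|T|.
Proof.
move=> deg; apply/colP => i; rewrite !mxE mulr1 -(deg (enum_val i)).
rewrite -sum1dep_card natr_sum [RHS]big_mkcond /=.
rewrite [RHS](reindex _ (onW_bij _ (@enum_val_bij T))).
by apply: eq_bigr => j _; rewrite !mxE mulr1; case: (e _ _).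
Qed.

(** The entries of A^2 count common neighbours: the valency on the diagonal, [m] elsewhere. Writing
    the valency as [d + m] makes [d] the difference k - mu without truncated subtraction. *)
Lemma adjacency_mx_sqr (R : pzSemiRingType) (T : finType) (e : rel T)
    (v d m : nat) :
  strongly_regular e v (d + m) m m ->
  adjacency_mx R e *m adjacency_mx R e = d%:R%:M + m%:R *: const_mx 1.
Proof.
move=> srg; apply/matrixP => i j; rewrite !mxE mulr1.
have -> : \sum_k adjacency_mx R e i k * adjacency_mx R e k j =
          #|[set z | e (enum_val i) z & e (enum_val j) z]|%:R.
  rewrite -sum1dep_card natr_sum [RHS]big_mkcond /=.
  rewrite [RHS](reindex _ (onW_bij _ (@enum_val_bij T))).
  apply: eq_bigr => k _; rewrite !mxE (srg_sym srg (enum_val k)).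
  by case: (e _ _); case: (e _ _); rewrite ?(mulr0, mul0r, mulr1).
have [->|ij] := eqVneq i j.
  rewrite mulr1n -natrD -(srg_deg srg (enum_val j)).
  by congr (_%:R); apply: eq_card => z; rewrite !inE andbb.
rewrite mulr0n add0r; have ne : enum_val i != enum_val j.
  by apply: contra ij => /eqP/enum_val_inj ->.
have [eij|eij] := boolP (e (enum_val i) (enum_val j)).
  by rewrite (srg_adj srg).
by rewrite (srg_nadj srg).
Qed.

(** This rank-one factorization of J shows that x J = 0 as soon as the entries of x sum to zero. *)
Lemma mulmx_const1 (R : pzSemiRingType) (n : nat) :
  (const_mx 1 : 'cV[R]_n) *m (const_mx 1 : 'rV[R]_n) = const_mx 1.
Proof. by apply/matrixP => i j; rewrite !mxE big_ord1 !mxE mulr1. Qed.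

Lemma srg_eigenvalue_valency (R : fieldType) (T : finType) (e : rel T) (k : nat) :
  (0 < #|T|)%N -> symmetric e -> (forall x, #|[set y | e x y]| = k) ->
  eigenvalue (adjacency_mx R e) k%:R.
Proof.
move=> T0 sym deg; apply/eigenvalueP; exists (const_mx 1); last first.
  apply/eqP => /rowP/(_ (Ordinal T0)); rewrite !mxE; apply/eqP; exact: oner_neq0.
(* [eigenvalue] refers to row vectors, so the identity for the all-ones column is transposed, using
   the symmetry of A. *)
apply: trmx_inj; rewrite trmx_mul linearZ /= trmx_const.
rewrite -(adjacency_mx_const _ _ _ _ deg); congr (_ *m _).
by apply/matrixP => i j; rewrite !mxE sym.
Qed.

Lemma srg_eigenvalue_sqr (R : fieldType) (T : finType) (e : rel T)
    (v d m : nat) (a : R) :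
  strongly_regular e v (d + m) m m -> eigenvalue (adjacency_mx R e) a ->
  a = (d + m)%:R \/ a ^+ 2 = d%:R.
Proof.
move=> srg /eigenvalueP[x xA x0].
have := congr1 (mulmx x) (adjacency_mx_const R _ _ _ (srg_deg srg)).
rewrite mulmxA xA -scalemxAl -scalemxAr => /eqP.
rewrite -subr_eq0 -scalerBl scaler_eq0 subr_eq0 => /orP[/eqP|/eqP xs]; first by left.
right; have := congr1 (mulmx x) (adjacency_mx_sqr R _ _ _ _ _ srg).
rewrite mulmxA xA -scalemxAl xA scalerA -expr2 mulmxDr mul_mx_scalar.
rewrite -scalemxAr -mulmx_const1 mulmxA xs mul0mx scaler0 addr0 => /eqP.
by rewrite -subr_eq0 -scalerBl scaler_eq0 (negPf x0) orbF subr_eq0 => /eqP.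
Qed.

Lemma srg_eigenvalue_intro (R : fieldType) (T : finType) (e : rel T)
    (v d m : nat) (a : R) (x y : T) :
  strongly_regular e v (d + m) m m -> a ^+ 2 = d%:R ->
  x != y -> (e x y)%:R != a -> eigenvalue (adjacency_mx R e) a.
Proof.
move=> srg a2 xy exy; set A := adjacency_mx R e.
pose i := enum_rank x; pose j := enum_rank y.
pose u : 'rV[R]_#|T| := delta_mx 0 i - delta_mx 0 j.
have uAA : u *m A *m A = a ^+ 2 *: u.
  rewrite -mulmxA (adjacency_mx_sqr _ _ _ _ _ _ srg) mulmxDr mul_mx_scalar.
  rewrite a2 -scalemxAr -mulmx_const1 mulmxA mulmxBl -!rowE !row_const subrr.
  by rewrite mul0mx scaler0 addr0.
apply/eigenvalueP; exists (u *m A + a *: u).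
  by rewrite mulmxDl uAA -scalemxAl [RHS]scalerDr scalerA -expr2 addrC.
(* The entry of w = u A + a u at [j] is A_ij - A_jj - a, and A_jj = 0; it vanishes only if A_ij =
   a. *)
apply: contra exy => /eqP/rowP/(_ j); rewrite mulmxBl -!rowE !mxE !enum_rankK.
rewrite (srg_irr srg) !eqxx subr0 (inj_eq enum_rank_inj) [y == x]eq_sym (negPf xy).
by rewrite sub0r mulrN1 => /eqP; rewrite subr_eq0.
Qed.

(** * Existence of non-adjacent points, and the parameters and spectrum of the graph *)

(** If some point were adjacent to all others, the number of vertices would be one more than the
    valency, which the vertex count excludes. *)
Lemma sp_non_adjacent (F : finFieldType) (nu : nat) :
  (2 <= nu)%N -> exists U V : sp_vertex F nu, U != V /\ ~~ sp_adj U V.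
Proof.
move=> nu2; set q := #|F|; have q1 : (1 < q)%N := card_finNzRing_gt1 _.
have vE : ((q - 1) * #|sp_vertex F nu| = q ^ (2 * nu) - 1)%N := card_sp_vertex F nu.
have N1 : (1 < 2 * nu - 1)%N by lia.
have /card_gt0P[U _] : (0 < #|sp_vertex F nu|)%N by apply: sp_vertex_gt0; lia.
case: (pickP [pred V | (U != V) && ~~ sp_adj U V]) => [V /andP[]|all_adj].
  by exists U, V.
have vS : #|sp_vertex F nu| = (q ^ (2 * nu - 1)).+1.
  rewrite -(sp_adj_degree _ _ U) -cardsT (cardsD1 U) in_setT; congr _.+1.
  apply: eq_card => V; rewrite !inE andbT.
  have := all_adj V; rewrite /= eq_sym.
  by case: eqVneq => [->|_ /negbFE]; rewrite ?sp_adj_irr.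
have qQ : (q < q ^ (2 * nu - 1))%N.
  by rewrite -[X in (X < _)%N]expn1 ltn_exp2l.
have QE : (q ^ (2 * nu) = q * q ^ (2 * nu - 1))%N.
  by rewrite -expnS; congr (q ^ _)%N; lia.
(* With Q = q^(2 nu - 1), the equation (q - 1)(Q + 1) = q Q - 1 forces Q = q, contradicting q <
   Q. *)
by move: vE; rewrite vS QE; nia.
Qed.

(** The eigenvalue q^(nu - 1) is guarded by [2 <= nu] because for nu = 1 the graph is complete on q
    + 1 vertices, with eigenvalues q and -1 only. *)
Theorem theorem2p1 (F : finFieldType) (q nu : nat) (hq : #|F| = q)
    (hnu : (1 <= nu)%N) (R : numFieldType) :
  strongly_regular (@sp_adj F nu)
    ((q ^ (2 * nu) - 1) %/ (q - 1))%N
    (q ^ (2 * nu - 1))%N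
    (q ^ (2 * nu - 2) * (q - 1))%N
    (q ^ (2 * nu - 2) * (q - 1))%N
  /\
  [/\ (forall a : R, eigenvalue (adjacency_mx R (@sp_adj F nu)) a ->
         [\/ a = q%:R ^+ (2 * nu - 1)%N,
             a = q%:R ^+ (nu - 1)%N |
             a = - q%:R ^+ (nu - 1)%N]),
      eigenvalue (adjacency_mx R (@sp_adj F nu)) (q%:R ^+ (2 * nu - 1)%N),
      ((2 <= nu)%N ->
         eigenvalue (adjacency_mx R (@sp_adj F nu)) (q%:R ^+ (nu - 1)%N)) &
      eigenvalue (adjacency_mx R (@sp_adj F nu)) (- q%:R ^+ (nu - 1)%N)].
Proof.
subst q; set q := #|F|; have q1 : (1 < q)%N := card_finNzRing_gt1 _.
have q0 : (0 < q - 1)%N by rewrite subn_gt0.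
have srg : strongly_regular (@sp_adj F nu) ((q ^ (2 * nu) - 1) %/ (q - 1))
    (q ^ (2 * nu - 1)) (q ^ (2 * nu - 2) * (q - 1)) (q ^ (2 * nu - 2) * (q - 1)).
  split=> [||||U V UV _|U V UV _].
  - exact: sp_adj_sym.
  - exact: sp_adj_irr.
  - by rewrite -card_sp_vertex mulKn.
  - exact: sp_adj_degree.
  - exact: sp_adj_common.
  - exact: sp_adj_common.
(* The valency in the form [d + m], with d = q^(2 nu - 2), the square of q^(nu - 1). *)
have dE : (q ^ (2 * nu - 1) = q ^ (2 * nu - 2) + q ^ (2 * nu - 2) * (q - 1))%N.
  have -> : (2 * nu - 1 = (2 * nu - 2).+1)%N by lia.
  by rewrite -mulnS subn1 prednK -?expnSr // ltnW.
have sqrE : (q%:R ^+ (nu - 1)) ^+ 2 = (q ^ (2 * nu - 2))%:R :> R.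
  by rewrite -exprM mulnBl natrX mulnC.
have edge : exists U V : sp_vertex F nu, U != V /\ sp_adj U V.
  have /card_gt0P[U _] := sp_vertex_gt0 F nu hnu.
  have /card_gt0P[V] : (0 < #|[set V | sp_adj U V]|)%N.
    by rewrite sp_adj_degree expn_gt0 ltnW.
  rewrite inE => UV; exists U, V; split=> //.
  by apply: contraTneq UV => ->; rewrite sp_adj_irr.
have s_gt0 : 0 < q%:R ^+ (nu - 1) :> R by rewrite exprn_gt0 // ltr0n ltnW.
have srg' := srg; rewrite dE in srg'.
split=> //; split.
- move=> a /(srg_eigenvalue_sqr _ _ _ _ _ _ _ srg')[->|].
    by rewrite -dE natrX; apply: Or31.
  rewrite -sqrE => /eqP; rewrite eqf_sqr => /orP[]/eqP ->; first exact: Or32.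
  exact: Or33.
- rewrite -natrX; apply: srg_eigenvalue_valency.
  + by have [U _] := edge; apply/card_gt0P; exists U.
  + exact: sp_adj_sym.
  + exact: sp_adj_degree.
(* A non-adjacent pair gives the matrix entry 0, which differs from the positive number q^(nu -
   1). *)
- move=> /(sp_non_adjacent F)[U [V [UV nUV]]].
  apply: (srg_eigenvalue_intro _ _ _ _ _ _ _ U V srg') => //.
  by rewrite (negPf nUV) eq_sym gt_eqF.
(* An edge gives the entry 1, which differs from the negative number -q^(nu - 1). *)
have [U [V [UV aUV]]] := edge.
apply: (srg_eigenvalue_intro _ _ _ _ _ _ _ U V srg') => //; first by rewrite sqrrN.
by rewrite aUV gt_eqF // (lt_trans _ ltr01) // oppr_lt0.
Qed.
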